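(* Let $\tau>0$ and $a>b\ge0$. Let $\Phi:[-\tau,\infty)\to[0,\infty)$ be locally bounded. Assume that, for every $t\ge0$, $$\limsup_{s\to t^+}\Phi(s)\le\Phi(t)\le\liminf_{s\to t^-}\Phi(s),$$ and that the upper right Dini derivative satisfies $$D^+\Phi(t)\le-a\Phi(t)+b\sup_{-\tau\le\theta\le0}\Phi(t+\theta),\qquad t\ge0.$$ Then there exists a unique $\mu>0$ satisfying $\mu=a-b\,\mathrm e^{\mu\tau}$, and for all $t\ge0$, $$\Phi(t)\le\mathrm e^{-\mu t}\sup_{-\tau\le s\le0}\Phi(s).$$
   Context: $D^+\Phi(t)=\limsup_{h\to0^+}\frac{\Phi(t+h)-\Phi(t)}{h}$. The function $\Phi$ is not assumed continuous. *)

(* Defs.v *)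
From mathcomp Require Import all_boot all_order all_algebra.
From mathcomp Require Import all_classical all_reals all_analysis.

Set Implicit Arguments.
Unset Strict Implicit.
Unset Printing Implicit Defensive.

Import Order.TTheory GRing.Theory Num.Theory.
Import numFieldNormedType.Exports.

Local Open Scope classical_set_scope.
Local Open Scope ring_scope.

(* Extended-real valued: it may be +oo or -oo. *)
Definition upper_right_dini (R : realType) (Phi : R -> R) (t : R) : \bar R :=
  limf_esup (fun h : R => ((Phi (t + h) - Phi t) / h)%:E) 0^'+.

(* Main.v *)
Require Import Defs.
From mathcomp Require Import all_boot all_order all_algebra.
From mathcomp Require Import all_classical all_reals all_analysis.
From mathcomp Require Import lra.

Import Order.TTheory GRing.Theory Num.Theory.
Import numFieldNormedType.Exports.

Local Open Scope classical_set_scope.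
Local Open Scope ring_scope.

(** Let [M] be the supremum of [Phi] over [[- tau, 0]].  For [0 < m < mu] and
    [K > M] the exponential [u t = K * expR (- m * t)] is a strict barrier for
    the delay inequality, because [- a + b * expR (m * tau) < - m]: if [Phi]
    stays below [u] up to a time [t] at which [Phi t = u t], then every delayed
    value is at most [expR (m * tau) * u t], so the upper right Dini derivative
    of [Phi] at [t] is smaller than the slope [- m * u t] of [u], and [Phi]
    remains below [u] just after [t] ([exp_barrier_contact]).

    Since [Phi] may jump, this local statement alone does not forbid a crossing.
    The two semicontinuity hypotheses do: at the infimum [t] of the times where
    [Phi > u], the left one transports [Phi <= u] from before [t] to [t] itself,
    and the right one says that a strict inequality at [t] persists after [t].
    So at [t] the barrier is either touched, which is the case treated above, or
    not reached, and both contradict the choice of [t] ([le_barrier]).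

    The estimate with the exact rate [mu] has no strictness to spare, hence it
    is obtained in the limit [K -> M], [m -> mu].  The rate [mu] is the unique
    zero of an increasing function, and [M] really bounds [Phi] because a
    locally bounded function is bounded on compact sets. *)

(** * Inequalities between limits inferior or superior and constants *)

Lemma limf_esup_lt_near (R : realType) (F : set_system R) (f : R -> \bar R)
    (c : \bar R) : Filter F ->
  (limf_esup f F < c)%E -> \forall x \near F, (f x < c)%E.
Proof.
move=> FF; rewrite limf_esupE => /ereal_inf_lt[_ [V FV <-] supV].
apply: filterS FV => x Vx; apply: le_lt_trans supV.
by apply: ereal_sup_ubound; exists x.
Qed.

Lemma lt_limf_einf_near (R : realType) (F : set_system R) (f : R -> \bar R)
    (c : \bar R) : Filter F ->
  (c < limf_einf f F)%E -> \forall x \near F, (c < f x)%E.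
Proof.
move=> FF; rewrite limf_einfE => /ereal_sup_gt[_ [V FV <-] infV].
apply: filterS FV => x Vx; apply: lt_le_trans infV _.
by apply: ereal_inf_lbound; exists x.
Qed.

Lemma upper_right_dini_lt (R : realType) (f : R -> R) (t c : R) :
  (upper_right_dini f t < c%:E)%E ->
  \forall h \near 0^'+, f (t + h) < f t + c * h.
Proof.
move=> /limf_esup_lt_near Dc; near=> h.
have h_gt0 : 0 < h by near: h; exact: nbhs_right_gt.
rewrite -ltrBlDl -ltr_pdivrMr// -lte_fin.
by near: h; exact: Dc.
Unshelve. all: by end_near. Qed.

(** * Comparison with a barrier *)

(** The first time at which [f] could cross [u] is excluded without continuity
    of [f]: upward jumps are forbidden by the semicontinuity on each side, and
    the last hypothesis handles the only remaining way of crossing, which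
    is to touch [u] first. *)
Lemma le_barrier (R : realType) (f u : R -> R) (t0 : R) :
  continuous u -> f t0 <= u t0 ->
  (forall t, t0 < t ->
     ((f t)%:E <= limf_einf (fun s : R => (f s)%:E) t^'-)%E) ->
  (forall t, t0 <= t ->
     (limf_esup (fun s : R => (f s)%:E) t^'+ <= (f t)%:E)%E) ->
  (forall t, t0 <= t -> (forall s, t0 <= s <= t -> f s <= u s) ->
     f t = u t -> \forall h \near 0^'+, f (t + h) <= u (t + h)) ->
  forall t, t0 <= t -> f t <= u t.
Proof.
move=> cu fu0 fl fr contact t1 t01; rewrite leNgt; apply/negP => ut1.
pose B := [set t | t0 <= t /\ u t < f t].
have B0 : B !=set0 by exists t1.
have lbB : lbound B t0 by move=> t [].
have hlB : has_lbound B by exists t0.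
pose t := inf B.
have t0t : t0 <= t by exact: lb_le_inf.
have below s : t0 <= s -> s < t -> f s <= u s.
  move=> t0s st; rewrite leNgt; apply/negP => us.
  by move: st; rewrite ltNge; move/negP; apply; apply: ge_inf.
have ftut : f t <= u t.
  move: t0t; rewrite le_eqVlt => /orP[/eqP <-//|t0t].
  rewrite leNgt; apply/negP => utft.
  pose c := (u t + f t) / 2.
  have uc : u t < c by rewrite /c; lra.
  have cf : c < f t by rewrite /c; lra.
  have Hf : \forall s \near t^'-, (c%:E < (f s)%:E)%E.
    by apply: lt_limf_einf_near; apply: lt_le_trans (fl _ t0t); rewrite lte_fin.
  have Hu : \forall s \near t^'-, u s < c.
    apply: cvgr_lt uc; apply: cvg_at_left_filter; exact: cu.
  have : \forall s \near t^'-, False.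
    near=> s.
    have cfs : c < f s by rewrite -lte_fin; near: s.
    have usc : u s < c by near: s.
    have : f s <= u s.
      by apply: below; near: s; [exact: nbhs_left_ge|exact: nbhs_left_lt].
    lra.
  by case/filter_ex.
have after : \forall s \near t^'+, f s <= u s.
  move: ftut; rewrite le_eqVlt => /orP[/eqP ftut|ftut].
    apply/nbhs_right0P; apply: contact => // s /andP[t0s].
    by rewrite le_eqVlt => /orP[/eqP ->|]; [rewrite ftut|exact: below].
  pose c := (u t + f t) / 2.
  have cu' : c < u t by rewrite /c; lra.
  have fc : f t < c by rewrite /c; lra.
  have Hf : \forall s \near t^'+, ((f s)%:E < c%:E)%E.
    by apply: limf_esup_lt_near; apply: le_lt_trans (fr _ t0t) _; rewrite lte_fin.
  have Hu : \forall s \near t^'+, c < u s.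
    apply: cvgr_gt cu'; apply: cvg_at_right_filter; exact: cu.
  near=> s.
  have fsc : f s < c by rewrite -lte_fin; near: s.
  have cus : c < u s by near: s.
  lra.
(* an interval after [t] without bad times contradicts that [t] is the infimum *)
have [e /= e0 te] := after.
have [s [t0s us] ste] : exists2 s, B s & s < t + e.
  by apply: inf_adherent.
have : f s <= u s.
  have ts : t <= s by apply: ge_inf.
  move: ts; rewrite le_eqVlt => /orP[/eqP <-//|ts].
  by apply: te => //=; rewrite distrC ger0_norm; lra.
lra.
Unshelve. all: by end_near. Qed.

(** * The exponential barrier *)

(** The convexity bound [1 - m * h <= expR (- m * h)] puts the barrier above its
    tangent, so that it can be compared with the Dini derivative directly. *)
Lemma exp_barrier_contact (R : realType) (f : R -> R) (K m t : R) :
  0 <= K -> f t = K * expR (- m * t) ->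
  (upper_right_dini f t < (- m * f t)%:E)%E ->
  \forall h \near 0^'+, f (t + h) <= K * expR (- m * (t + h)).
Proof.
move=> K0 ft /upper_right_dini_lt; apply: filterS => h /ltW /le_trans; apply.
rewrite mulrDr expRD mulrA -ft.
have ft0 : 0 <= f t by rewrite ft mulr_ge0// expR_ge0.
have := ler_wpM2l ft0 (expR_ge1Dx (- m * h)); lra.
Qed.

(** The strict inequality on [m] is what makes the Dini derivative smaller than
    the slope of the barrier at a contact time.  Starting strictly below it,
    with [M < K], makes [K] positive even if [M = 0], so that the slopes really
    differ at a contact. *)
Lemma halanay_subrate (R : realType) (tau a b M K m : R) (Phi : R -> R)
  (tau_gt0 : 0 < tau) (b_ge0 : 0 <= b) (M_ge0 : 0 <= M) (M_lt_K : M < K)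
  (m_gt0 : 0 < m) (m_lt : m < a - b * expR (m * tau))
  (Phi_le : forall s : R, - tau <= s <= 0 -> Phi s <= M)
  (Phi_right : forall t : R, 0 <= t ->
     (limf_esup (fun s : R => (Phi s)%:E) t^'+ <= (Phi t)%:E)%E)
  (Phi_left : forall t : R, 0 <= t ->
     ((Phi t)%:E <= limf_einf (fun s : R => (Phi s)%:E) t^'-)%E)
  (Phi_dini : forall t : R, 0 <= t ->
     (upper_right_dini Phi t <=
      (- a * Phi t + b * sup [set Phi (t + theta) | theta in `[- tau, 0]])%:E)%E)
  (t : R) : 0 <= t -> Phi t <= K * expR (- m * t).
Proof.
have K_gt0 : 0 < K by lra.
move: t; apply: (@le_barrier R Phi (fun t => K * expR (- m * t)) 0) => //.
- move=> s; apply: cvgM; first exact: cvg_cst.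
  apply: continuous_comp; last exact: continuous_expR.
  by apply: cvgM; [exact: cvg_cst|exact: cvg_id].
- rewrite mulr0 expR0 mulr1; apply: ltW; apply: le_lt_trans M_lt_K.
  by apply: Phi_le; lra.
- by move=> s /ltW; exact: Phi_left.
move=> t t0 below Phit; apply: exp_barrier_contact; [exact: ltW|exact: Phit|].
apply: le_lt_trans (Phi_dini _ t0) _; rewrite lte_fin.
have Phit_gt0 : 0 < Phi t by rewrite Phit mulr_gt0// expR_gt0.
have supP : sup [set Phi (t + theta) | theta in `[- tau, 0]] <=
    Phi t * expR (m * tau).
  apply: ge_sup.
    by exists (Phi (t + 0)), 0 => //=; rewrite in_itv/=; lra.
  move=> _ [theta /= /[!in_itv]/= /andP[tau_th th0] <-].
  rewrite Phit -mulrA -expRD.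
  have [t_th|t_th] := leP 0 (t + theta).
    apply: le_trans (below _ _) _; first by lra.
    by rewrite ler_pM2l// ler_expR; nra.
  (* before time 0 the barrier is at least [K], as it is decreasing *)
  apply: (@le_trans _ _ K).
    by apply: le_trans (ltW M_lt_K); apply: Phi_le; lra.
  rewrite ler_peMr//; first exact: ltW.
  by rewrite -expR0 ler_expR; nra.
have := ler_wpM2l b_ge0 supP.
have : m * Phi t < (a - b * expR (m * tau)) * Phi t by rewrite ltr_pM2r.
lra.
Qed.

(** * The characteristic equation and local boundedness *)

(** The root is the solution of [m + b * expR (m * tau) = a], whose left-hand
    side increases strictly from [b < a] at [0] to at least [a] at [a]. *)
Lemma characteristic_root (R : realType) (tau a b : R) :
  0 < tau -> 0 <= b -> b < a ->
  exists mu : R, unique (fun m : R => 0 < m /\ m = a - b * expR (m * tau)) mu.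
Proof.
move=> tau0 b0 ba; pose g m := m + b * expR (m * tau).
have g_lt x y : x < y -> g x < g y.
  move=> xy; apply: ltr_leD => //; apply: ler_wpM2l => //.
  by rewrite ler_expR ler_pM2r// ltW.
have cg : continuous g.
  move=> x; apply: cvgD; first exact: cvg_id.
  apply: cvgM; first exact: cvg_cst.
  apply: continuous_comp; last exact: continuous_expR.
  by apply: cvgM; [exact: cvg_id|exact: cvg_cst].
have a0 : 0 <= a by lra.
have g0 : g 0 = b by rewrite /g mul0r expR0; lra.
have ga : a <= g a by rewrite /g lerDl mulr_ge0// expR_ge0.
have [||mu /[!in_itv]/= /andP[mu0 _] gmu] := @IVT R g 0 a a a0.
- exact: continuous_subspaceT.
- by rewrite ge_min le_max g0 ga (ltW ba)/= orbT.
exists mu; split=> [|m [_ mE]].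
  split; last by rewrite -gmu /g; lra.
  rewrite lt_neqAle mu0 andbT; apply/eqP => mu0'.
  by move: gmu; rewrite -mu0' g0; lra.
have gm : g m = g mu by rewrite gmu /g {1}mE; lra.
by have [/g_lt|/g_lt|//] := ltgtP mu m; rewrite gm ltxx.
Qed.

Lemma locally_bounded_compact (R : realType) (T : topologicalType)
    (f : T -> R) (A K : set T) : compact K -> K `<=` A ->
  [locally [bounded f x | x in A]] -> [bounded f x | x in K].
Proof.
move=> /compact_near_coveringP/near_covering_withinP cK KA fb.
apply: cK => x Kx.
have /pinfty_ex_gt0[N _ fN] := fb x (KA _ Kx).
near=> y N' => /= Ky.
have /(_ (KA _ Ky)) fyN : A y -> `|f y| <= N by near: y; exact: fN.
apply: le_trans fyN _.
by near: N'; apply: nbhs_pinfty_ge; rewrite num_real.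
Unshelve. all: by end_near. Qed.

Theorem lemma3p3 (R : realType) (tau a b : R) (Phi : R -> R)
  (tau_gt0 : 0 < tau) (b_ge0 : 0 <= b) (b_lt_a : b < a)
  (Phi_ge0 : forall t : R, - tau <= t -> 0 <= Phi t)
  (Phi_locally_bounded : [locally [bounded Phi t | t in `[- tau, +oo[%classic]])
  (Phi_right : forall t : R, 0 <= t ->
     (limf_esup (fun s : R => (Phi s)%:E) t^'+ <= (Phi t)%:E)%E)
  (Phi_left : forall t : R, 0 <= t ->
     ((Phi t)%:E <= limf_einf (fun s : R => (Phi s)%:E) t^'-)%E)
  (Phi_dini : forall t : R, 0 <= t ->
     (upper_right_dini Phi t <=
      (- a * Phi t + b * sup [set Phi (t + theta) | theta in `[- tau, 0]])%:E)%E) :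
  exists mu : R,
    unique (fun m : R => 0 < m /\ m = a - b * expR (m * tau)) mu /\
    forall t : R, 0 <= t ->
      Phi t <= expR (- mu * t) * sup [set Phi s | s in `[- tau, 0]].
Proof.
have [mu mu_unique] := @characteristic_root R tau a b tau_gt0 b_ge0 b_lt_a.
exists mu; split=> // t t0; have [[mu_gt0 muE] _] := mu_unique.
set M := sup _.
have sub : `[- tau, 0]%classic `<=` `[- tau, +oo[%classic.
  by move=> s /=; rewrite !in_itv/= => /andP[-> _].
have /pinfty_ex_gt0[N _ PhiN] :=
  locally_bounded_compact _ _ _ _ _ (@segment_compact R _ _) sub Phi_locally_bounded.
have Phi_le s : - tau <= s <= 0 -> Phi s <= M.
  move=> s_itv; apply: ub_le_sup; last by exists s => //=; rewrite in_itv.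
  exists N => _ [r r_itv <-]; apply: le_trans (ler_norm _) _.
  exact: PhiN.
have M_ge0 : 0 <= M by apply: le_trans (Phi_ge0 0 _) (Phi_le 0 _); lra.
(* the admissible pairs [K = M + e], [m = mu - e] tend to [M], [mu] *)
have Phi_e : \forall e \near 0^'+, Phi t <= expR (- (mu - e) * t) * (M + e).
  near=> e.
  have e_gt0 : 0 < e by near: e; exact: nbhs_right_gt.
  have e_lt_mu : e < mu by near: e; exact: nbhs_right_lt.
  rewrite mulrC; apply: (@halanay_subrate R tau a b M) => //; [lra|lra|].
  have : b * expR ((mu - e) * tau) <= b * expR (mu * tau).
    by apply: ler_wpM2l => //; rewrite ler_expR ler_pM2r//; lra.
  lra.
have lim_e : expR (- (mu - e) * t) * (M + e) @[e --> 0^'+] --> expR (- mu * t) * M.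
  apply: cvg_at_right_filter.
  rewrite -[in X in _ --> X](subr0 mu) -[in X in _ --> X](addr0 M).
  apply: cvgM; last by apply: cvgD; [exact: cvg_cst|exact: cvg_id].
  apply: continuous_cvg; first exact: continuous_expR.
  apply: cvgM; last exact: cvg_cst.
  by apply: cvgN; apply: cvgB; [exact: cvg_cst|exact: cvg_id].
rewrite -(cvg_lim _ lim_e)//; apply: limr_ge => //.
by apply/cvg_ex; eexists; exact: lim_e.
Unshelve. all: by end_near. Qed.
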